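(* Any random field is restored by its $1f$-distribution. That is, if $P$ and $P'$ are (positive) random fields whose $1f$-distributions $Q_1^f(P)=\{Q_t^z\}$ and $Q_1^f(P')=\{Q_t'^{z}\}$ coincide, i.e. $Q_t^z(x)=Q_t'^{z}(x)$ for all $t\in\mathbb{Z}^d$, $z\in\widehat{X_t^f}$, $x\in X^t$, then $P=P'$.
   Context: $X\subset\mathbb{R}$ is a finite set with $1<|X|<\infty$, and $d\ge 1$. For $S\subset\mathbb{Z}^d$, $W(S)$ is the set of all finite subsets of $S$, and $W=W(\mathbb{Z}^d)$. $X^S$ is the set of configurations on $S$ (functions $S\to X$). Braces are omitted for one-point sets, e.g. $X^t=X^{\{t\}}$. For disjoint $S,T$ and $x\in X^S$, $y\in X^T$, $xy\in X^{S\cup T}$ is the concatenation. For $t\in\mathbb{Z}^d$, $\widehat{X_t^f}=\bigcup_{\emptyset\neq S\in W(\mathbb{Z}^d\setminus\{t\})}X^S$. A random field is a probability measure $P$ on $X^{\mathbb{Z}^d}$ with the $\sigma$-algebra generated by cylinder sets; $P_V$ denotes its marginal on $X^V$, $V\in W$. All random fields are assumed positive: $P_V(x)>0$ for all $V\in W$, $x\in X^V$. The $1f$-distribution (one-point finite-conditional distribution) of $P$ is the system $Q_1^f(P)=\{Q_t^z, z\in\widehat{X_t^f}, t\in\mathbb{Z}^d\}$, where for $z\in X^S$, $\emptyset\neq S\in W(\mathbb{Z}^d\setminus\{t\})$, $Q_t^z(x)=P_{\{t\}\cup S}(xz)/P_S(z)$, $x\in X^t$. *)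

(* Defs.v *)
From HB Require Import structures.
From mathcomp Require Import all_boot all_order all_algebra finmap.
From mathcomp Require Import all_classical all_reals all_analysis.

Set Implicit Arguments.
Unset Strict Implicit.
Unset Printing Implicit Defensive.

Import Order.TTheory GRing.Theory Num.Theory.

Local Open Scope fset_scope.
Local Open Scope classical_set_scope.
Local Open Scope ring_scope.

(* The finite set X seen as a type.  The library only puts sigma-algebras on
   pointed types; the proof of 1 < |X| is a parameter of the type so that the
   point can be chosen in X. *)
Definition spin (R : realType) (X : {fset R}) (hX : (1 < #|` X|)%N) : Type :=
  X.

Section spin_instances.
Context (R : realType) (X : {fset R}) (hX : (1 < #|` X|)%N).

Lemma spin_inhabited : {x : R | x \in X}.
Proof.
have /fset0Pn : X != fset0 by rewrite -cardfs_gt0 (ltn_trans _ hX).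
by move=> /cid.
Qed.

HB.instance Definition _ := Finite.copy (spin hX) X.
HB.instance Definition _ :=
  isPointed.Build (spin hX) [` projT2 spin_inhabited].

End spin_instances.

Notation site d := 'rV[int]_d.

Section random_fields.
Context (R : realType) (X : {fset R}) (hX : (1 < #|` X|)%N) (d : nat).

(* A configuration on a finite set S of sites is a finite map with domain S. *)
Definition fconf : Type := {fmap site d -> spin hX}.

Definition confs (S : {fset site d}) : set fconf := [set x | domf x = S].

Definition restr (V : {fset site d}) (w : site d -> spin hX) : fconf :=
  [fmap s : V => w (val s)].

Definition cylinders : set (set (site d -> spin hX)) :=
  [set A | exists (V : {fset site d}) (B : set fconf), A = restr V @^-1` B].

(* A member of this type is a function on all sets of configurations, but its
   values are only meaningful on the measurable ones: equality of random fields
   means equality on cylinders.-sigma.-measurable sets. *)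
Definition random_field : Type := probability (g_sigma_algebraType cylinders) R.

Definition marginal (P : random_field) (V : {fset site d}) (x : fconf) : R :=
  fine (P (restr V @^-1` [set x])).

Definition positive_field (P : random_field) : Prop :=
  forall (V : {fset site d}) (x : fconf), confs V x -> 0 < marginal P V x.

Definition boundary_confs (t : site d) : set fconf :=
  \bigcup_(S in [set S : {fset site d} | S <> fset0 /\ t \notin S]) confs S.

(* Used for x with domain {t} and z in boundary_confs t; the domains being
   disjoint, [catf x z] is the concatenation xz. *)
Definition one_f_dist (P : random_field) (t : site d) (z x : fconf) : R :=
  marginal P ([fset t] `|` domf z)%fset (catf x z) / marginal P (domf z) z.

End random_fields.

Arguments cylinders {R X} hX d.

(* Main.v *)
Require Import Defs.
From mathcomp Require Import all_boot all_order all_algebra finmap.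
From mathcomp Require Import all_classical all_reals all_analysis.

Set Implicit Arguments.
Unset Strict Implicit.
Unset Printing Implicit Defensive.

Import Order.TTheory GRing.Theory Num.Theory.

Local Open Scope fset_scope.
Local Open Scope classical_set_scope.
Local Open Scope ring_scope.

(** Compare the two fields through the ratio r_V(x) = P_V(x) / P'_V(x), which
    makes sense because P' is positive.  Equality of the conditional
    distributions at a site t given a nonempty S not containing t says exactly
    that adding t to S leaves the ratio unchanged: r_{t,S}(xz) = r_S(z)
    ([likelihood_ratio_fset1U]).

    Conditioning on the empty set is not available, so the one-point marginals
    have to be reached through a second site s.  Growing {t,s} from {t} and from
    {s} gives r_t(x) = r_{t,s}(xy) = r_s(y).  The left side is independent of y
    and the right side of x, so r_t is a constant; both one-point marginals have
    total mass 1, hence that constant is 1 ([likelihood_ratio_site]).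
    Adding the sites of V one at a time then yields r_V = 1 for every nonempty V
    ([likelihood_ratio_eq1]).

    Thus P and P' have the same finite-dimensional marginals.  These determine
    them on cylinders, which form a pi-system generating the sigma-algebra. *)

(** * Configurations and cylinders *)

Section configurations.
Context (R : realType) (X : {fset R}) (hX : (1 < #|` X|)%N) (d : nat).
Implicit Types (V S : {fset site d}) (w : site d -> spin hX).

Lemma fnd_restr V w s :
  (restr V w).[? s]%fmap = if s \in V then Some (w s) else None.
Proof.
case: ifP => sV; last by rewrite not_fnd //= sV.
by rewrite in_fnd //= ffunE.
Qed.

Lemma eq_restrP V w w' : restr V w = restr V w' <-> {in V, w =1 w'}.
Proof.
split=> [eq_ww' s sV|eq_ww'].
  have := congr1 (fun x : fconf hX d => x.[? s]%fmap) eq_ww'.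
  by rewrite !fnd_restr sV => -[].
by apply/fmapP => s; rewrite !fnd_restr; case: ifP => // /eq_ww' ->.
Qed.

Lemma catf_restr V S w : catf (restr V w) (restr S w) = restr (V `|` S)%fset w.
Proof.
apply/fmapP => s; rewrite fnd_cat !fnd_restr inE /=.
by case: (s \in S); rewrite ?orbT ?orbF.
Qed.

Lemma restr_surj V (f : {ffun V -> spin hX}) : exists w, FinMap f = restr V w.
Proof.
exists (fun s => odflt point (FinMap f).[? s]%fmap).
by apply/fmapP => s; rewrite fnd_restr; case: fndP.
Qed.

Lemma cylinder_measurable V (B : set (fconf hX d)) :
  measurable (restr V @^-1` B : set (g_sigma_algebraType (cylinders hX d))).
Proof. by apply: sub_sigma_algebra; exists V, B. Qed.

(** Two cylinders with bases V and U are both cylinders over V `|` U, since a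
    configuration on V `|` U determines its restrictions to V and U. *)
Lemma cylinders_setI : setI_closed (cylinders hX d).
Proof.
move=> _ _ [V [B ->]] [U [D ->]].
exists (V `|` U)%fset,
  (restr (V `|` U)%fset @` (restr V @^-1` B `&` restr U @^-1` D)).
apply/seteqP; split=> w /=; first by move=> BDw; exists w.
case=> w' [Bw' Dw'] /eq_restrP eq_ww'; split.
  have <- // : restr V w' = restr V w.
  by apply/eq_restrP => s sV; apply: eq_ww'; rewrite inE sV.
have <- // : restr U w' = restr U w.
by apply/eq_restrP => s sU; apply: eq_ww'; rewrite inE sU orbT.
Qed.

Lemma marginalE (P : random_field hX d) V x :
  P (restr V @^-1` [set x]) = (marginal P V x)%:E.
Proof.
by rewrite fineK //; apply: fin_num_measure; exact: cylinder_measurable.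
Qed.

Lemma cylinder_measure_sum (P : random_field hX d) V (B : set (fconf hX d)) :
  P (restr V @^-1` B) =
  (\sum_(f \in [set f : {ffun V -> spin hX} | B (FinMap f)])
      (marginal P V (FinMap f))%:E)%E.
Proof.
under eq_fsbigr do rewrite -marginalE.
rewrite -measure_fin_bigcup.
- congr (P _); apply/seteqP; split=> w /=.
  + by move=> Bw; exists [ffun s : V => w (val s)].
  + by case=> f Bf /= ->.
- exact: finite_finset.
- move=> f g _ _ [w [/= -> eq_fg]].
  apply/ffunP => s; apply: Some_inj.
  have := congr1 (fun x : fconf hX d => x.[? val s]%fmap) eq_fg.
  by rewrite -(Some_fnd (f := FinMap f)) -(Some_fnd (f := FinMap g)).
- by move=> f _; exact: cylinder_measurable.
Qed.

(** With B = setT both sides are total masses and c is forced to be 1; with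
    c = 1 equality of the marginals passes to every cylinder over V. *)
Lemma cylinder_measure_proportional (P P' : random_field hX d) V (c : R) :
    (forall w, marginal P V (restr V w) = c * marginal P' V (restr V w)) ->
  forall B, P (restr V @^-1` B) = (c%:E * P' (restr V @^-1` B))%E.
Proof.
move=> PP' B; rewrite !cylinder_measure_sum ge0_mule_fsumr; last first.
  by move=> f; rewrite -marginalE measure_ge0.
apply: eq_fsbigr => f _; have [w ->] := restr_surj f.
by rewrite PP' EFinM.
Qed.

End configurations.

(** * The likelihood ratio of fields with the same conditional distributions *)

Section likelihood_ratio.
Context (R : realType) (X : {fset R}) (hX : (1 < #|` X|)%N) (d : nat).
Context (P P' : random_field hX d).
Hypotheses (hP : positive_field P) (hP' : positive_field P').
Hypothesis hQ : forall (t : site d) (z x : fconf hX d),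
  boundary_confs t z -> confs [fset t]%fset x ->
  one_f_dist P t z x = one_f_dist P' t z x.
Implicit Types (V S : {fset site d}) (w : site d -> spin hX) (s t : site d).

Definition likelihood_ratio V w :=
  marginal P V (restr V w) / marginal P' V (restr V w).

Lemma likelihood_ratio_fset1U S t w : S != fset0 -> t \notin S ->
  likelihood_ratio (t |` S)%fset w = likelihood_ratio S w.
Proof.
move=> /eqP S0 tS.
have bS : boundary_confs t (restr S w) by exists S.
have := hQ bS (erefl : confs [fset t]%fset (restr [fset t]%fset w)).
rewrite /one_f_dist catf_restr /= /likelihood_ratio.
have : marginal P S (restr S w) != 0 by rewrite gt_eqF // hP.
have : marginal P' S (restr S w) != 0 by rewrite gt_eqF // hP'.
have : marginal P' (t |` S)%fset (restr (t |` S)%fset w) != 0.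
  by rewrite gt_eqF // hP'.
move=> n1 n2 n3 /eqP; rewrite eqr_div // => /eqP e.
by apply/eqP; rewrite eqr_div // e mulrC.
Qed.

(** The values at t and s can be varied independently: this is where two
    distinct sites are used. *)
Lemma likelihood_ratio_site s t w : s != t -> likelihood_ratio [fset t] w = 1.
Proof.
move=> st; have ts : t != s by rewrite eq_sym.
have ratio_swap v : likelihood_ratio [fset t] v = likelihood_ratio [fset s] v.
  rewrite -(@likelihood_ratio_fset1U [fset t] s) ?inE //; last first.
    by apply/fset0Pn; exists t; rewrite inE.
  rewrite fsetUC likelihood_ratio_fset1U ?inE //.
  by apply/fset0Pn; exists s; rewrite inE.
have ratio_local u v v' : v u = v' u ->
    likelihood_ratio [fset u] v = likelihood_ratio [fset u] v'.
  move=> vv'; rewrite /likelihood_ratio.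
  suff -> : restr [fset u] v = restr [fset u] v' by [].
  by apply/eq_restrP => r; rewrite inE => /eqP ->.
have ratio_const v : likelihood_ratio [fset t] v = likelihood_ratio [fset t] w.
  (* the configuration equal to v at t and to w at s links the two ratios *)
  pose m r := if r == t then v r else w r.
  rewrite (@ratio_local t v m); last by rewrite /m eqxx.
  by rewrite ratio_swap (@ratio_local s m w) -?ratio_swap // /m (negPf st).
have prop v : marginal P [fset t] (restr [fset t] v) =
    likelihood_ratio [fset t] w * marginal P' [fset t] (restr [fset t] v).
  by rewrite -(ratio_const v) /likelihood_ratio divfK // gt_eqF // hP'.
have := cylinder_measure_proportional prop setT.
rewrite preimage_setT.
have -> : P setT = 1%E by exact: probability_setT.
have -> : P' setT = 1%E by exact: probability_setT.
by rewrite mule1 => -[].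
Qed.

Lemma likelihood_ratio_eq1 V w : (0 < d)%N -> V != fset0 ->
  likelihood_ratio V w = 1.
Proof.
move=> d0; elim/fset1U_rect: V => [|t S tS IH _]; first by rewrite eqxx.
have [->|S0] := eqVneq (S : {fset site d}) fset0; last first.
  by rewrite likelihood_ratio_fset1U ?IH.
rewrite fsetU0; apply: (@likelihood_ratio_site (t + const_mx 1)).
apply/eqP => /rowP /(_ (Ordinal d0)) /eqP; rewrite !mxE.
by rewrite -subr_eq0 (addrC (t _ _)) addrK oner_eq0.
Qed.

Lemma eq_measure_cylinder V (B : set (fconf hX d)) : (0 < d)%N ->
  P (restr V @^-1` B) = P' (restr V @^-1` B).
Proof.
move=> d0; have [->|V0] := eqVneq V fset0.
  (* all configurations restrict to the same one on the empty set *)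
  have [Bx|nBx] := pselect (B (restr fset0 point)).
    have -> : restr fset0 @^-1` B = setT.
      rewrite -subTset => w _ /=.
      by have -> : restr fset0 w = restr fset0 point by apply/eq_restrP.
    by rewrite [LHS]probability_setT [RHS]probability_setT.
  have -> : restr fset0 @^-1` B = set0.
    rewrite -subset0 => w /=.
    by have -> : restr fset0 w = restr fset0 point by apply/eq_restrP.
  by rewrite !measure0.
rewrite (@cylinder_measure_proportional _ _ _ _ P P' V 1) ?mul1e // => w.
rewrite -(likelihood_ratio_eq1 w d0 V0) /likelihood_ratio divfK //.
by rewrite gt_eqF // hP'.
Qed.

End likelihood_ratio.

(** * Uniqueness of the random field *)

Theorem theorem5 (R : realType) (X : {fset R}) (hX : (1 < #|` X|)%N)
    (d : nat) (hd : (1 <= d)%N) (P P' : random_field hX d)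
    (hP : positive_field P) (hP' : positive_field P')
    (hQ : forall (t : site d) (z x : fconf hX d),
      boundary_confs t z -> confs [fset t]%fset x ->
      one_f_dist P t z x = one_f_dist P' t z x) :
  forall A : set (site d -> spin hX),
    (cylinders hX d).-sigma.-measurable A -> P A = P' A.
Proof.
apply: (@measure_unique _ R (g_sigma_algebraType (cylinders hX d))
  (cylinders hX d) (fun=> setT) _ _ _ _ P P') => //.
- exact: cylinders_setI.
- by move=> _; exists fset0, setT; rewrite preimage_setT.
- by rewrite bigcup_const //; exists 0%N.
- by move=> _ [V [B ->]]; exact: eq_measure_cylinder.
- by move=> _; rewrite [ltLHS]probability_setT ltry.
Qed.
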